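(* Let $r,d\geq 1$ be integers and let $\mathcal{S}$ be a rank $r-1$ incidence structure. There is some $\chi\in\mathcal{X}^\bullet_{r,d}$ with $\mathcal{S}_\chi$ equivalent to $\mathcal{S}$, if and only if $\mathcal{S}$ is equivalent to an incidence structure corresponding to an $(r-1)$-partite intersection graph of nonempty, path-connected, compact subsets of $\mathbb{R}^{d-1}$.
   Context: Incidence structures. A rank $k$ incidence structure is a tuple $\mathcal{S}=(P_1,\dots,P_k,I)$ where the $P_i$ are disjoint finite index sets and $I\subseteq\bigcup_{i<j}P_i\times P_j$. Two structures $(P_1,\dots,P_k,I_1)$ and $(P_1',\dots,P_k',I_2)$ are equivalent if there are bijections $P_i\cong P_i'$ for all $i$ under which $I_1$ and $I_2$ have the same transitive closure as relations on $\bigcup_iP_i\cong\bigcup_iP_i'$. A $k$-partite graph is an undirected finite graph $(V,E)$ with a partition $V=V_1\cup\dots\cup V_k$ (parts may be empty) such that every edge joins vertices in different parts. It corresponds to the incidence structure with $P_i=V_i$ and $(v,w)\in I$ if and only if $\{v,w\}\in E$, $v\in V_i$, $w\in V_j$, $i<j$. Intersection graphs. The intersection graph of a finite collection of subsets $\{K_i\subseteq U\mid 1\le i\le m\}$ of a set $U$ has vertex set $\{1,\dots,m\}$ and an edge between two (distinct) vertices $i,j$ if and only if $K_i\cap K_j\neq\emptyset$. Characteristic functions. On $\mathbb{Z}_{\ge0}^d$ write $\mathbf{a}\le\mathbf{b}$ if $a_i\le b_i$ for all $i$. $\mathcal{X}^n_{r,d}$ is the set of functions $\chi\colon\mathbb{Z}^d_{\ge0}\to\mathbb{Z}$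 of the form $\chi(\mathbf{a})=\dim_kF_{\mathbf{a}}$ for some field $k$ and some $\mathbb{Z}^d$-graded quotient module $k[x_1,\dots,x_d]^r\to F=\bigoplus_{\mathbf{a}}F_{\mathbf{a}}$ with $\dim_kF=n$ (here $\prod x_i^{a_i}$ has degree $\mathbf{a}$). Equivalently, $0\le\chi\le r$, $\sum_{\mathbf{a}}\chi(\mathbf{a})=n$, and $\mathbf{a}\le\mathbf{b}$ implies $\chi(\mathbf{a})\ge\chi(\mathbf{b})$. Put $\mathcal{X}^\bullet_{r,d}=\bigcup_{n\ge0}\mathcal{X}^n_{r,d}$. The structure $\mathcal{S}_\chi$. Two elements of $\mathbb{Z}^d_{\ge0}$ are adjacent if they agree in all coordinates but one, where they differ by $1$. A subset $A\subseteq\mathbb{Z}^d_{\ge0}$ is connected if any two of its elements are joined by a finite sequence in $A$ of consecutively adjacent elements; connected components are maximal connected subsets. For $\chi\in\mathcal{X}^n_{r,d}$ and $1\le i\le r-1$, let $P_{i,\chi}$ be the set of connected components of $\chi^{-1}(r-i)$, and let $I_\chi$ be the set of pairs $(p,q)\in\bigcup_{i<j}P_{i,\chi}\times P_{j,\chi}$ for which there are adjacent $\mathbf{a}\in p$, $\mathbf{b}\in q$ with $\mathbf{a}\le\mathbf{b}$. Then $\mathcal{S}_\chi=(P_{1,\chi},\dots,P_{r-1,\chi},I_\chi)$. *)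

(* Defs.v *)
From HB Require Import structures.
From Stdlib Require Import Relations.Relation_Operators.
From mathcomp Require Import all_boot all_order all_algebra.
From mathcomp Require Import all_classical all_reals all_analysis.
(* the notations of mpoly clash with those of mathcomp-analysis *)
From mathcomp Require Import -(notations) mpoly.

Set Implicit Arguments.
Unset Strict Implicit.
Unset Printing Implicit Defensive.

Import Order.TTheory GRing.Theory Num.Theory.
Import numFieldNormedType.Exports.

Local Open Scope classical_set_scope.
Local Open Scope ring_scope.

(** Incidence structures *)

(* The classes of points are numbered from 0, and their disjoint union is the
   sigma type [{i & pts S i}].  Finiteness of the classes is stated separately
   ([finite_structure]), so that [structure_of] below is defined for every
   function on the lattice. *)
Record incidence_structure (k : nat) := IncidenceStructure {
  pts : 'I_k -> Type;
  inc : {i : 'I_k & pts i} -> {i : 'I_k & pts i} -> Prop;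
  inc_lt : forall p q, inc p q -> (tag p < tag q)%N }.

Definition finite_structure (k : nat) (S : incidence_structure k) : Prop :=
  forall i : 'I_k, finite_set [set: pts S i].

Definition equivalent (k : nat) (S T : incidence_structure k) : Prop :=
  exists f : forall i : 'I_k, pts S i -> pts T i,
    (forall i, bijective (f i)) /\
    (forall p q : {i : 'I_k & pts S i},
       clos_trans _ (@inc k S) p q <->
       clos_trans _ (@inc k T) (Tagged (pts T) (f (tag p) (tagged p)))
                               (Tagged (pts T) (f (tag q) (tagged q)))).

(** Multipartite graphs and intersection graphs *)

Record graph := Graph {
  vertex :> finType;
  edge : vertex -> vertex -> Prop;
  edge_sym : forall v w, edge v w -> edge w v;
  edge_irrefl : forall v, ~ edge v v }.

(* [part] encodes the partition of the vertices into the possibly empty parts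
   [V_i = part^-1(i)]. *)
Definition multipartite (k : nat) (G : graph) (part : G -> 'I_k) : Prop :=
  forall v w : G, edge v w -> part v != part w.

Section StructureOfGraph.
Variables (k : nat) (G : graph) (part : G -> 'I_k).

Definition graph_pts (i : 'I_k) : Type := {v : G | part v == i}.

Definition graph_inc (p q : {i : 'I_k & graph_pts i}) : Prop :=
  edge (val (tagged p)) (val (tagged q)) /\ (tag p < tag q)%N.

Lemma graph_inc_lt p q : graph_inc p q -> (tag p < tag q)%N.
Proof. by case. Qed.

Definition structure_of_graph : incidence_structure k :=
  IncidenceStructure graph_inc_lt.

End StructureOfGraph.

Section IntersectionGraph.
Variables (U : Type) (m : nat) (K : 'I_m -> set U).

Definition intersection_edge (i j : 'I_m) : Prop :=
  i != j /\ K i `&` K j !=set0.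

Lemma intersection_edge_sym i j :
  intersection_edge i j -> intersection_edge j i.
Proof. by case=> ij Kij; split; rewrite 1?eq_sym // setIC. Qed.

Lemma intersection_edge_irrefl i : ~ intersection_edge i i.
Proof. by case; rewrite eqxx. Qed.

Definition intersection_graph : graph :=
  @Graph 'I_m intersection_edge intersection_edge_sym intersection_edge_irrefl.

End IntersectionGraph.

Definition path_connected (R : realType) (T : topologicalType) (A : set T) :
    Prop :=
  forall x y : T, A x -> A y ->
    exists g : R -> T,
      [/\ {within `[0, 1], continuous g}, g 0 = x, g 1 = y &
          forall t : R, 0 <= t <= 1 -> A (g t)].

(** Characteristic functions.  Points of the lattice Z_{>=0}^d are represented
    by the exponent vectors [multinom d]. *)

(* A graded quotient module of k[x_1, ..., x_d]^r is given by its kernel [K], a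
   submodule containing the homogeneous components of all of its elements. *)
Section GradedQuotient.
Variables (k : fieldType) (d r : nat).
Local Notation free_module := 'rV[mpoly d k]_r.

Definition homog_component (a : multinom d) (v : free_module) : free_module :=
  \row_j (mpolyC d (mcoeff a (v 0 j)) * mpolyX k a).

Definition homog (a : multinom d) : set free_module :=
  [set v | homog_component a v = v].

Definition graded_submodule (K : set free_module) : Prop :=
  [/\ K 0,
      forall u v, K u -> K v -> K (u + v),
      forall (p : mpoly d k) v, K v -> K (p *: v) &
      forall a v, K v -> K (homog_component a v)].

(* The image of the k-subspace [W] in the quotient by [K] has dimension [n]: it
   has a basis consisting of the classes of [n] elements of [W]. *)
Definition quotient_dim (W K : set free_module) (n : nat) : Prop :=
  exists b : 'I_n -> free_module,
    (forall i, W (b i)) /\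
    (forall v, W v -> exists! c : 'rV[k]_n,
       K (v - \sum_(i < n) mpolyC d (c 0 i) *: b i)).

End GradedQuotient.

Definition charfun (r d n : nat) (chi : multinom d -> int) : Prop :=
  exists (k : fieldType) (K : set 'rV[mpoly d k]_r),
    [/\ graded_submodule K,
        quotient_dim setT K n &
        forall a, exists2 m : nat, chi a = m%:Z & quotient_dim (homog a) K m].

(** The structure attached to a characteristic function *)

Definition adjacent (d : nat) : rel (multinom d) := fun a b =>
  [exists i, ((a i == (b i).+1) || (b i == (a i).+1)) &&
             [forall j, (j != i) ==> (a j == b j)]].

Definition lattice_connected (d : nat) (A : set (multinom d)) : Prop :=
  forall a b, A a -> A b ->
    exists s : seq (multinom d),
      [/\ path (@adjacent d) a s, last a s = b & forall c, c \in s -> A c].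

(* Components are nonempty: the empty set has none. *)
Definition component (d : nat) (X C : set (multinom d)) : Prop :=
  [/\ C !=set0, C `<=` X, lattice_connected C &
      forall D : set (multinom d),
        D `<=` X -> lattice_connected D -> C `<=` D -> D = C].

Section StructureOf.
Variables (r d : nat) (chi : multinom d -> int).

Definition level (i : 'I_r.-1) : set (multinom d) :=
  [set a | chi a = r%:Z - i.+1%:Z].

Definition level_pts (i : 'I_r.-1) : Type :=
  {C : set (multinom d) | component (level i) C}.

Definition level_inc (p q : {i : 'I_r.-1 & level_pts i}) : Prop :=
  (tag p < tag q)%N /\
  exists a b : multinom d,
    [/\ sval (tagged p) a, sval (tagged q) b, adjacent a b &
        forall i, (a i <= b i)%N].

Lemma level_inc_lt p q : level_inc p q -> (tag p < tag q)%N.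
Proof. by case. Qed.

Definition structure_of : incidence_structure r.-1 :=
  IncidenceStructure level_inc_lt.

End StructureOf.

(* Main.v *)
From HB Require Import structures.
From Stdlib Require Import Relations.Relation_Operators.
From mathcomp Require Import all_boot all_order all_algebra.
From mathcomp Require Import all_classical all_reals all_analysis.
From mathcomp Require Import zify ring lra.
From mathcomp Require Import -(notations) mpoly.
Require Import Defs.

(** Both directions rest on one remark about a monotone [chi]: if [a <= b] are
    lattice points lying in components [p] and [q], then walking up from [a] to
    [b] one coordinate step at a time never increases [chi], so every change of
    component met on the way is an incidence, and [p = q] or [q] is reachable
    from [p] ([mnmle_clos_trans]).  Hence comparability of points is seen by the
    transitive closure of the incidence relation, and only the transitive
    closure matters for equivalence.

    From [chi] to sets.  Attach to a lattice point [a] the projection of the cube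
    [a + [0, 1/2]^d] along the diagonal [(1, ..., 1)], a compact convex subset of
    R^(d-1), and to a component the union of the sets attached to its points.
    If two cubes contain points that differ by [t (1, ..., 1)], the sign of [t]
    makes their corners comparable ([cell_meet_comparable]); conversely
    adjacent lattice points have intersecting projections, because half a
    diagonal leads from one cube to the other ([cell_meet_adjacent]).  So the
    unions are path-connected, the intersection graph contains all incidences,
    and each of its edges is a comparability, hence is in the transitive
    closure.

    From sets to [chi].  After rescaling, replace every compact set by the lattice
    points of Z^(d-1) near it ([discretization]).  This keeps nonempty
    intersections, and a large scale makes disjoint sets as far apart as needed.
    Lift the lattice points of the vertex [v] to the level set of the degree
    [N + 2 * part v + 1] in Z^d by choosing the first coordinate, and let [chi]
    be [r] below degree [N] and, from there on, the largest value
    [r - 1 - part v] over the [v] such that the point lies below a lifted point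
    of [v].  The level sets of [chi] then decompose into one connected region per
    vertex.  The heights are bounded by [2 * r], so adjacent regions of distinct
    vertices come from intersecting sets; and a common lattice point of two
    vertices has comparable lifts, so intersecting sets give related regions
    ([structure_of_real_chi]).

    The algebra enters through two facts.  A characteristic function is monotone,
    because multiplication by a monomial maps a homogeneous piece of the quotient
    onto a later one, and it has finite support ([charfun_props]).  Conversely a
    monotone function of finite support with values at most [r] is the
    characteristic function of a sum of quotients by monomial ideals
    ([charfun_intro]). *)

Set Implicit Arguments.
Unset Strict Implicit.
Unset Printing Implicit Defensive.

Import Order.TTheory GRing.Theory Num.Theory.
Import numFieldNormedType.Exports.

Local Open Scope classical_set_scope.
Local Open Scope ring_scope.

(** * Equivalence of incidence structures *)

Definition sigma_map (k : nat) (S T : incidence_structure k)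
    (f : forall i : 'I_k, pts S i -> pts T i) (p : {i : 'I_k & pts S i}) :
    {i : 'I_k & pts T i} :=
  Tagged (pts T) (f (tag p) (tagged p)).

Lemma equivalent_sym k (S T : incidence_structure k) :
  equivalent S T -> equivalent T S.
Proof.
case=> f [bij_f f_ct].
have inv_f i : exists g : pts T i -> pts S i, cancel (f i) g /\ cancel g (f i).
  by case: (bij_f i) => g; exists g.
pose g i := sval (cid (inv_f i)).
have gP i : cancel (f i) (g i) /\ cancel (g i) (f i) := svalP (cid (inv_f i)).
exists g; split=> [i|[i x] [j y]].
  by exists (f i); case: (gP i).
have /= -> := f_ct (Tagged _ (g i x)) (Tagged _ (g j y)).
by case: (gP i) => _ ->; case: (gP j) => _ ->.
Qed.

Lemma equivalent_trans k (S T U : incidence_structure k) :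
  equivalent S T -> equivalent T U -> equivalent S U.
Proof.
case=> f [bij_f f_ct] [g [bij_g g_ct]].
exists (fun i => g i \o f i); split=> [i|p q]; first exact: bij_comp.
by rewrite f_ct g_ct.
Qed.

Lemma finite_structure_equivalent k (S T : incidence_structure k) :
  equivalent S T -> finite_structure S -> finite_structure T.
Proof.
move=> [f [bij_f _]] finS i; have [g fK gK] := bij_f i.
have -> : [set: pts T i] = f i @` [set: pts S i].
  by apply/seteqP; split=> // y _; exists (g y).
exact: finite_image (finS i).
Qed.

Lemma clos_trans_lt k (S : incidence_structure k) (p q : {i : 'I_k & pts S i}) :
  clos_trans _ (@inc k S) p q -> (tag p < tag q)%N.
Proof. by elim=> [x y /inc_lt //|x y z _ xy _]; exact: ltn_trans. Qed.

Lemma Tagged_inj (I : eqType) (P : I -> Type) (i : I) (x y : P i) :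
  Tagged P x = Tagged P y -> x = y.
Proof.
move=> e; have := projT2_eq e.
by rewrite (Prop_irrelevance (projT1_eq e) erefl).
Qed.

(** The transitive closures agree as soon as each relation generates a relation
    contained in the transitive closure of the other. *)
Lemma equivalent_of_inc k (S T : incidence_structure k)
    (f : forall i : 'I_k, pts S i -> pts T i) :
  (forall i, bijective (f i)) ->
  (forall p q, inc p q ->
     clos_trans _ (@inc k T) (sigma_map f p) (sigma_map f q)) ->
  (forall p q, inc (sigma_map f p) (sigma_map f q) ->
     clos_trans _ (@inc k S) p q) ->
  equivalent S T.
Proof.
move=> bij_f f_inc inc_f; exists f; split=> // p q; split=> [|pq].
  elim=> [x y /f_inc //|x y z _ xy _ yz]; exact: t_trans xy yz.
have f_surj p' : exists p0, p' = sigma_map f p0.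
  case: p' => i y; case: (bij_f i) => g _ gK.
  by exists (Tagged _ (g y)); rewrite /sigma_map /= gK.
suff H P Q : clos_trans _ (@inc k T) P Q -> forall p q,
    P = sigma_map f p -> Q = sigma_map f q -> clos_trans _ (@inc k S) p q.
  exact: H pq _ _ erefl erefl.
elim=> [x y xy p0 q0 ? ?|x y z _ IHxy _ IHyz p0 q0 xE zE]; first by subst; exact: inc_f.
by have [y0 yE] := f_surj y; apply: t_trans (IHxy _ _ xE yE) (IHyz _ _ yE zE).
Qed.

(** Turns the points of a finite structure into the vertices ['I_m] of an
    intersection graph. *)
Lemma sigma_enum k (P : 'I_k -> Type) : (forall i, finite_set [set: P i]) ->
  exists (m : nat) (g : 'I_m -> {i : 'I_k & P i}), bijective g.
Proof.
move=> finP.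
have fin : finite_set [set: {i : 'I_k & P i}].
  have -> : [set: {i : 'I_k & P i}] =
      \bigcup_(i in [set: 'I_k]) (Tagged P @` [set: P i]).
    by apply/seteqP; split=> // -[i x] _; exists i => //; exists x.
  by apply: bigcup_finite => // i _; exact: finite_image.
have /finite_setP[m] := fin.
rewrite (card_eqr card_II) card_eq_sym => /card_bijP[f [g fK gK]].
exists m, (fun i => val (f (to_setT i))), (fun x => val (g (to_setT x))) => x.
  have -> : to_setT (val (f (to_setT x))) = f (to_setT x) by exact: val_inj.
  by rewrite fK.
have -> : to_setT (val (g (to_setT x))) = g (to_setT x) by exact: val_inj.
by rewrite gK.
Qed.

(** * Paths and components in the lattice *)

Section Lattice.
Variable d : nat.
Implicit Types (a b c : multinom d) (A B X C : set (multinom d)).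

Definition mnmle a b := forall i, (a i <= b i)%N.

Lemma mnmle_refl a : mnmle a a. Proof. by move=> i. Qed.
Lemma mnmle_trans b a c : mnmle a b -> mnmle b c -> mnmle a c.
Proof. by move=> ab bc i; exact: leq_trans (ab i) (bc i). Qed.

Lemma mnmle_mdeg a b : mnmle a b -> (mdeg a <= mdeg b)%N.
Proof. by move=> ab; rewrite !mdegE; apply: leq_sum. Qed.

Lemma mnmle_diff a b i : mnmle a b -> (b i - a i <= mdeg b - mdeg a)%N.
Proof.
move=> ab; rewrite !mdegE -sumnB // (bigD1 i) //=; exact: leq_addr.
Qed.

Definition msucc a i : multinom d := mnm_add a (mnm1 i).

Lemma msuccE a i j : msucc a i j = (a j + (i == j))%N.
Proof. by rewrite /msucc mnmDE mnm1E. Qed.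

Lemma mdeg_msucc a i : mdeg (msucc a i) = (mdeg a).+1.
Proof. by rewrite /msucc mdegD mdeg1 addn1. Qed.

Lemma mnmle_msucc a i : mnmle a (msucc a i).
Proof. by move=> j; rewrite msuccE leq_addr. Qed.

Lemma adjacent_sym a b : adjacent a b = adjacent b a.
Proof.
apply/existsP/existsP => -[i /andP[H /forallP K]]; exists i; rewrite orbC H /=;
  by apply/forallP => j; rewrite [X in _ ==> X]eq_sym.
Qed.

Lemma adjacent_msucc a i : adjacent a (msucc a i).
Proof.
apply/existsP; exists i; rewrite !msuccE eqxx addn1 eqxx orbT /=.
by apply/forallP => j; apply/implyP => ji; rewrite msuccE [i == j]eq_sym (negPf ji) addn0.
Qed.

Lemma adjacentP a b : adjacent a b -> exists i, b = msucc a i \/ a = msucc b i.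
Proof.
case/existsP => i /andP[ai /forallP aj]; exists i.
case/orP: ai => /eqP e; [right|left]; apply/mnmP => j; rewrite msuccE;
  case: eqVneq => [<-|ij]; rewrite ?e ?addn1 // addn0;
  by have := aj j; rewrite eq_sym ij => /eqP.
Qed.

Lemma mnmle_step a b : mnmle a b -> a <> b -> exists i, mnmle (msucc a i) b.
Proof.
move=> ab neq; have [/forallP H|] := boolP [forall i, a i == b i].
  by case: neq; apply/mnmP => i; exact/eqP.
rewrite negb_forall => /existsP[i ai]; exists i => j; rewrite msuccE.
by have := ab j; case: eqVneq => [<-|]; rewrite ?addn0 // addn1 ltn_neqAle ai.
Qed.

(** Unlike in [lattice_connected], the starting point is required to be in [A],
    which makes [linked A] an equivalence relation on [A]. *)
Definition linked A a b :=
  exists s : seq (multinom d),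
    [/\ path (@adjacent d) a s, last a s = b & forall c, c \in a :: s -> A c].

Lemma linked_refl A a : A a -> linked A a a.
Proof. by move=> Aa; exists [::]; split=> // c; rewrite inE => /eqP ->. Qed.

Lemma linked_trans A b a c : linked A a b -> linked A b c -> linked A a c.
Proof.
move=> [s [sa sb sA]] [t [tb tc tA]]; exists (s ++ t); split.
- by rewrite cat_path sa sb.
- by rewrite last_cat sb.
- move=> x; rewrite -cat_cons mem_cat => /orP[/sA //|xt].
  by apply: tA; rewrite inE xt orbT.
Qed.

Lemma linked_adj A a b : A a -> A b -> adjacent a b -> linked A a b.
Proof.
move=> Aa Ab ab; exists [:: b]; split=> //=; first by rewrite ab.
by move=> c; rewrite !inE => /orP[] /eqP ->.
Qed.

Lemma linked_sym A a b : linked A a b -> linked A b a.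
Proof.
move=> [s [sa sb sA]]; elim: s a sa sb sA => [|c s IH] a /=.
  by move=> _ <- sA; apply: linked_refl; apply: sA; rewrite inE.
move=> /andP[ac cs] sb sA.
have Aa : A a by apply: sA; rewrite inE eqxx.
have Ac : A c by apply: sA; rewrite !inE eqxx orbT.
apply: (@linked_trans _ c); last by apply: linked_adj => //; rewrite adjacent_sym.
by apply: IH => // x xs; apply: sA; rewrite inE xs orbT.
Qed.

Lemma linked_sub A B a b : A `<=` B -> linked A a b -> linked B a b.
Proof. by move=> AB [s [? ? sA]]; exists s; split=> // c /sA /AB. Qed.

Lemma linked_ind A (P : multinom d -> Prop) a b :
  linked A a b -> P a ->
  (forall x y, A x -> A y -> adjacent x y -> P x -> P y) -> P b.
Proof.
move=> [s [+ + +]] + H; elim: s a => [|c s IH] a /=; first by move=> _ ->.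
move=> /andP[ac cs] sb sA Pa; apply: IH cs sb _ _.
  by move=> x xs; apply: sA; rewrite inE xs orbT.
by apply: H ac Pa; apply: sA; rewrite !inE eqxx ?orbT.
Qed.

Lemma linkedP A a b : linked A a b -> A a /\ A b.
Proof.
move=> ab; have Aa : A a by case: ab => s [_ _]; apply; rewrite inE eqxx.
by split=> //; apply: linked_ind ab _ _.
Qed.

Lemma lattice_connectedP A :
  lattice_connected A <-> forall a b, A a -> A b -> linked A a b.
Proof.
split=> H a b Aa Ab; have [s [sa sb sA]] := H a b Aa Ab; exists s; split=> // c.
  by rewrite inE => /orP[/eqP -> //|/sA].
by move=> cs; apply: sA; rewrite inE cs orbT.
Qed.

(** A saturated chain from [a] to [b] is a lattice path. *)
Lemma linked_mnmle A a b : mnmle a b ->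
  (forall c, mnmle a c -> mnmle c b -> A c) -> linked A a b.
Proof.
have [n] := ubnP (mdeg b - mdeg a); elim: n a => // n IH a ltn ab H.
have Aa : A a by apply: H => //; exact: mnmle_refl.
have [->|neq] := eqVneq a b; first by apply: linked_refl; exact: H.
have [i ib] := mnmle_step ab (elimN eqP neq).
have Ai : A (msucc a i) by apply: H => //; exact: mnmle_msucc.
apply: linked_trans (linked_adj Aa Ai (adjacent_msucc a i)) _; apply: IH => //.
  by have := mnmle_mdeg ib; rewrite mdeg_msucc; lia.
by move=> c ic cb; apply: H => //; apply: mnmle_trans ic; exact: mnmle_msucc.
Qed.

Lemma component_of X a : X a -> exists2 C, component X C & C a.
Proof.
move=> Xa; exists (linked X a); last exact: linked_refl.
split.
- by exists a; exact: linked_refl.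
- by move=> b ab; have [_] := linkedP ab.
- apply/lattice_connectedP => b c ab ac.
  have : linked X b c by apply: linked_trans ac; exact: linked_sym.
  move=> [s [sb sc sX]]; exists s; split=> // x xs.
  (* every point of the path is itself linked to [a], through an initial segment *)
  have [n xE] : exists n, x = last b (take n s).
    move: xs; rewrite inE => /orP[/eqP ->|/path.splitP[p1 p2]]; first by exists 0%N; rewrite take0.
    by exists (size (rcons p1 x)); rewrite take_size_cat // last_rcons.
  apply: linked_trans ab _; exists (take n s); split=> //.
    by move: sb; rewrite -{1}(cat_take_drop n s) cat_path => /andP[].
  by move=> y; rewrite inE => /orP[/eqP ->|/mem_take ys]; apply: sX; rewrite inE ?eqxx ?ys ?orbT.
- move=> D DX /lattice_connectedP Dc CD; apply/seteqP; split=> // b Db.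
  apply: linked_sub DX _; apply: Dc => //; apply: CD; exact: linked_refl.
Qed.

(** Otherwise adding [b] would give a larger connected set. *)
Lemma component_adj X C a b : component X C -> C a -> X b ->
  a = b \/ adjacent a b -> C b.
Proof.
move=> [_ CX /lattice_connectedP Cc Cmax] Ca Xb [<- //|ab].
suff <- : C `|` [set b] = C by right.
apply: Cmax; last by move=> x; left.
  by move=> x [/CX //|->].
have la x : C x -> linked (C `|` [set b]) x a.
  by move=> Cx; apply: (@linked_sub C) => [y|]; [left|exact: Cc].
have lb : linked (C `|` [set b]) a b by apply: linked_adj => //; [left|right].
apply/lattice_connectedP.
have to_a x : (C `|` [set b]) x -> linked (C `|` [set b]) x a.
  by case=> [/la //|->]; exact: linked_sym.
by move=> x y /to_a xa /to_a ya; exact: linked_trans xa (linked_sym ya).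
Qed.

Lemma component_eq X C D a : component X C -> component X D -> C a -> D a -> C = D.
Proof.
move=> cC cD Ca Da.
suff H E F : component X E -> component X F -> E a -> F a -> E `<=` F.
  by apply/seteqP; split; exact: H.
move=> [_ EX /lattice_connectedP Ec _] cF Ea Fa x Ex.
apply: (@linked_ind E F a x); [exact: Ec| by []|].
by move=> y z Ey Ez yz Fy; apply: component_adj cF Fy (EX _ Ez) _; right.
Qed.

End Lattice.

(** * Characteristic functions as monotone functions *)

Section Graded.
Variables (k : fieldType) (d r : nat).
Local Notation free_module := 'rV[mpoly d k]_r.
Implicit Types (v w : free_module) (K W : set free_module) (a b : multinom d).

Definition coef a (j : 'I_r) v : k := mcoeff a (v 0 j).

Lemma coefP v w : (forall a j, coef a j v = coef a j w) -> v = w.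
Proof. by move=> e; apply/rowP => j; apply/mpolyP => a; exact: e. Qed.

Lemma coef0 a j : coef a j 0 = 0.
Proof. by rewrite /coef mxE mcoeff0. Qed.

Lemma coefD a j v w : coef a j (v + w) = coef a j v + coef a j w.
Proof. by rewrite /coef mxE mcoeffD. Qed.

Lemma coefB a j v w : coef a j (v - w) = coef a j v - coef a j w.
Proof. by rewrite /coef !mxE mcoeffB. Qed.

Lemma coef_sum a j I (s : seq I) (F : I -> free_module) :
  coef a j (\sum_(i <- s) F i) = \sum_(i <- s) coef a j (F i).
Proof.
elim: s => [|i s IH]; first by rewrite !big_nil coef0.
by rewrite !big_cons coefD IH.
Qed.

Lemma coefC a j c v : coef a j (mpolyC d c *: v) = c * coef a j v.
Proof. by rewrite /coef mxE mcoeffCM. Qed.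

Lemma coef_homog a b j v :
  coef b j (homog_component a v) = if a == b then coef b j v else 0.
Proof.
rewrite /coef mxE mcoeffCM mcoeffX.
by case: eqP => [->|]; rewrite ?mulr1 ?mulr0.
Qed.

Lemma homogP a v : homog a v <-> forall b j, b != a -> coef b j v = 0.
Proof.
split=> [<- b j ba|H]; first by rewrite coef_homog eq_sym (negPf ba).
apply: coefP => b j; rewrite coef_homog.
by case: eqVneq => // ab; rewrite H // eq_sym.
Qed.

Lemma homog0 a : homog a (0 : free_module).
Proof. by apply/homogP => b j _; rewrite coef0. Qed.

Section Submodule.
Variables (K : set free_module) (gradK : graded_submodule K).

Lemma submod_sum n (F : 'I_n -> free_module) :
  (forall i, K (F i)) -> K (\sum_i F i).
Proof. by case: gradK => K0 KD _ _ FK; apply: big_ind. Qed.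

Lemma submod_scale c v : K v -> K (mpolyC d c *: v).
Proof. by case: gradK => _ _ KZ _; exact: KZ. Qed.

Lemma basis_independent W n (e : 'I_n -> free_module) : W 0 ->
  (forall v, W v -> exists! c : 'rV[k]_n,
     K (v - \sum_(i < n) mpolyC d (c 0 i) *: e i)) ->
  forall c : 'rV[k]_n, K (\sum_i mpolyC d (c 0 i) *: e i) -> c = 0.
Proof.
move=> W0 He c Kc; have [c0 [_ uniq_c]] := He 0 W0.
have -> : c = - - c by rewrite opprK.
rewrite -(uniq_c (- c)); last first.
  rewrite sub0r -sumrN.
  by under eq_bigr => i _ do rewrite mxE mpolyCN scaleNr opprK.
rewrite (uniq_c 0) ?oppr0 // sub0r -sumrN.
under eq_bigr => i _ do rewrite mxE mpolyC0 scale0r oppr0.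
by rewrite big1_eq; case: gradK.
Qed.

(** The usual comparison of an independent family with a generating one: were
    [m > n], the matrix of coordinates of the [w i] would have a nonzero left
    kernel, hence the [w i] a relation. *)
Lemma independent_card W n m (w : 'I_m -> free_module) :
  quotient_dim W K n -> (forall i, W (w i)) ->
  (forall c : 'rV[k]_m, K (\sum_i mpolyC d (c 0 i) *: w i) -> c = 0) ->
  (m <= n)%N.
Proof.
move=> [e [_ He]] Ww indep; rewrite leqNgt; apply/negP => ltnm.
pose M := \matrix_(i < m) sval (cid (He _ (Ww i))).
have MP i : K (w i - \sum_j mpolyC d (M i j) *: e j).
  have [Kc _] := svalP (cid (He _ (Ww i))).
  by under eq_bigr => j _ do rewrite mxE.
have : kermx M != 0.
  by rewrite -mxrank_eq0 mxrank_ker subn_eq0 -ltnNge (leq_ltn_trans (rank_leq_col M)).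
case/rowV0Pn => c /sub_kermxP cM /eqP; apply; apply: indep.
have -> : \sum_i mpolyC d (c 0 i) *: w i =
    \sum_i mpolyC d (c 0 i) *: (w i - \sum_j mpolyC d (M i j) *: e j).
  under [RHS]eq_bigr => i _ do rewrite scalerBr scaler_sumr.
  rewrite sumrB exchange_big /= [X in _ - X]big1 ?subr0 // => j _.
  under eq_bigr => i _ do rewrite scalerA -mpolyCM.
  rewrite -scaler_suml -raddf_sum.
  have := congr1 (fun v : 'rV[k]_n => v 0 j) cM.
  by rewrite !mxE => ->; rewrite /= mpolyC0 scale0r.
by apply: submod_sum => i; exact: submod_scale.
Qed.

(** A basis in degree [b] consists of multiples, by the monomial of exponent
    [b - a], of elements of degree [a], and these are independent because a
    relation between them can be multiplied by that monomial. *)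
Lemma quotient_dim_mono a b m n : mnmle a b ->
  quotient_dim (homog a) K m -> quotient_dim (homog b) K n -> (n <= m)%N.
Proof.
move=> ab dim_a [e [e_homog He]].
pose u i : free_module := \row_j (mpolyC d (coef b j (e i)) * mpolyX k a).
have eE i : e i = mpolyX k (mnm_sub b a) *: u i.
  rewrite -(e_homog i); apply/rowP => j; rewrite !mxE mulrCA -mpolyXD.
  suff -> : mnm_add (mnm_sub b a) a = b by [].
  by apply/mnmP => l; rewrite mnmDE mnmBE subnK.
apply: (independent_card dim_a (w := u)) => [i|c Kc].
  apply/homogP => a' j a'a; rewrite /coef mxE mcoeffCM mcoeffX.
  by rewrite eq_sym (negPf a'a) mulr0.
apply: (basis_independent (homog0 b) He).
have -> : \sum_i mpolyC d (c 0 i) *: e i =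
    mpolyX k (mnm_sub b a) *: \sum_i mpolyC d (c 0 i) *: u i.
  by rewrite scaler_sumr; apply: eq_bigr => i _; rewrite eE !scalerA mulrC.
by case: gradK => _ _ KZ _; exact: KZ.
Qed.

(** Nonzero classes in distinct degrees are independent, since the submodule
    contains the homogeneous components of its elements. *)
Lemma support_card N m (s : 'I_m -> multinom d) :
  quotient_dim setT K N -> injective s ->
  (forall i, ~ quotient_dim (homog (s i)) K 0) -> (m <= N)%N.
Proof.
move=> dimK s_inj Hs.
have wP i : exists w, homog (s i) w /\ ~ K w.
  apply: contrapT => noW; apply: (Hs i).
  exists (fun _ => 0); split=> [[]//|v hv]; exists 0; split=> [|c _].
    rewrite big_ord0 subr0; apply: contrapT => Kv; apply: noW; by exists v.
  by apply/rowP => -[].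
pose w i := sval (cid (wP i)).
have w_ok i : homog (s i) (w i) /\ ~ K (w i) := svalP (cid (wP i)).
apply: (independent_card dimK (w := w)) => // c Kc.
apply/rowP => i; rewrite mxE; apply/eqP/negP => /negP ci.
case: (w_ok i) => _; apply.
case: gradK => _ _ KZ /(_ (s i) _ Kc) Kci.
suff -> : w i = mpolyC d (c 0 i)^-1 *:
    homog_component (s i) (\sum_j mpolyC d (c 0 j) *: w j) by exact: KZ.
apply: coefP => a j; rewrite coefC coef_homog coef_sum.
case: eqVneq => [<-|sia]; last first.
  by rewrite mulr0; case: (w_ok i) => /homogP -> //; rewrite eq_sym.
rewrite (bigD1 i) //= big1 ?addr0 ?coefC ?mulKf // => l li.
rewrite coefC; case: (w_ok l) => /homogP -> //; first by rewrite mulr0.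
by rewrite (inj_eq s_inj) eq_sym.
Qed.

End Submodule.

Section Monomial.
Variable chi : multinom d -> nat.
Hypothesis chi_mono : forall a b, mnmle a b -> (chi b <= chi a)%N.

(** The direct sum over [j] of the monomial ideals spanned by the monomials [a]
    with [chi a <= j]. *)
Definition monomial_submodule : set free_module :=
  [set v | forall a (j : 'I_r), (j < chi a)%N -> coef a j v = 0].

Lemma monomial_graded : graded_submodule monomial_submodule.
Proof.
split.
- by move=> a j _; rewrite coef0.
- by move=> u v Ku Kv a j ja; rewrite coefD Ku // Kv // addr0.
- move=> p v Kv a j ja; rewrite /coef mxE mcoeffM big1 // => -[m1 m2] /= /eqP aE.
  suff -> : mcoeff m2 (v 0 j) = 0 by rewrite mulr0.
  apply: Kv; apply: leq_trans ja (chi_mono _) => i.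
  by have /mnmP/(_ i) -> := aE; rewrite mnmDE leq_addl.
- by move=> a v Kv b j jb; rewrite coef_homog; case: ifP => // _; exact: Kv.
Qed.

Definition monomial_vector (x : multinom d * 'I_r) : free_module :=
  mpolyX k x.1 *: delta_mx 0 x.2.

Lemma coef_monomial a j x : coef a j (monomial_vector x) = ((a, j) == x)%:R.
Proof.
case: x => b l; rewrite /coef !mxE eqxx /= xpair_eqE.
case: (eqVneq j l) => _ ; first by rewrite mulr1 mcoeffX andbT eq_sym.
by rewrite mulr0 mcoeff0 andbF.
Qed.

(** The monomial vectors outside of the submodule give a basis of the quotient.
    Used with [W] the whole module and with [W] a homogeneous piece. *)
Lemma monomial_dim (W : set free_module) n (e : 'I_n -> multinom d * 'I_r) :
  injective e -> (forall i, W (monomial_vector (e i))) ->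
  (forall i, ((e i).2 < chi (e i).1)%N) ->
  (forall v a (j : 'I_r), W v -> (j < chi a)%N ->
     (exists i, e i = (a, j)) \/ coef a j v = 0) ->
  quotient_dim W monomial_submodule n.
Proof.
move=> e_inj eW e_chi We; exists (fun i => monomial_vector (e i)).
split=> // v Wv; exists (\row_i coef (e i).1 (e i).2 v); split=> [a j ja|c Kc].
  rewrite coefB coef_sum.
  under eq_bigr => i _ do rewrite coefC coef_monomial mxE.
  case: (We v a j Wv ja) => [[i ei]|coef_v].
    rewrite (bigD1 i) //= ei eqxx mulr1 big1 ?addr0 ?subrr // => l li.
    by rewrite -ei (inj_eq e_inj) eq_sym (negPf li) mulr0.
  rewrite coef_v big1 ?subr0 // => i _; case: eqP => [<-|_]; last by rewrite mulr0.
  by rewrite coef_v mul0r.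
apply/rowP => i; rewrite mxE; apply/eqP; rewrite -subr_eq0; apply/eqP.
have := Kc _ _ (e_chi i); rewrite coefB coef_sum (bigD1 i) //= big1 ?addr0.
  by rewrite coefC coef_monomial -surjective_pairing eqxx mulr1.
move=> l li; rewrite coefC coef_monomial -surjective_pairing (inj_eq e_inj).
by rewrite eq_sym (negPf li) mulr0.
Qed.

End Monomial.
End Graded.

Section Charfun.
Variables (r d : nat).

Lemma charfun_props n (chi : multinom d -> int) : charfun r n chi ->
  (forall a b, mnmle a b -> chi b <= chi a) /\ finite_set [set a | 0 < chi a].
Proof.
move=> [k [K [gradK dimK chiP]]]; split.
  move=> a b ab; case: (chiP a) (chiP b) => m -> dim_a [l -> dim_b].
  by rewrite lez_nat; exact: quotient_dim_mono ab dim_a dim_b.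
apply: contrapT => /(@infinite_set_fset _ _ n.+1)[B BP Bn].
pose s (i : 'I_n.+1) := nth (@mnm0 d) (finmap.enum_fset B) i.
have sB i : s i \in finmap.enum_fset B by apply: mem_nth; exact: leq_trans (ltn_ord i) Bn.
suff : (n.+1 <= n)%N by rewrite ltnn.
apply: (support_card gradK (s := s)) => // [i j /eqP|i].
  rewrite nth_uniq ?finmap.fset_uniq ?(leq_trans (ltn_ord _) Bn) //.
  by move=> /eqP /val_inj.
move=> dim0; have /= := BP _ (sB i); case: (chiP (s i)) => -[|m] -> // dimS _.
by have := quotient_dim_mono gradK (fun j => leqnn (s i j)) dim0 dimS.
Qed.

Lemma charfun_intro (chi : multinom d -> nat) (b : nat) :
  (forall a, (chi a <= r)%N) -> (forall a b, mnmle a b -> (chi b <= chi a)%N) ->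
  (forall a, (b <= mdeg a)%N -> chi a = 0%N) ->
  exists n, charfun r n (fun a => (chi a)%:Z).
Proof.
move=> chi_r chi_mono chi0.
exists #|{: {x : bmultinom d b * 'I_r | (x.2 < chi x.1)%N} }|.
exists rat, (monomial_submodule chi); split.
- exact: monomial_graded.
- pose e (i : 'I_#|{: {x : bmultinom d b * 'I_r | (x.2 < chi x.1)%N} }|) :
      multinom d * 'I_r := (val (val (enum_val i)).1 , (val (enum_val i)).2).
  apply: (monomial_dim (e := e)) => //.
  + move=> i j [/val_inj e1 e2]; apply: enum_val_inj; apply: val_inj.
    by rewrite [LHS]surjective_pairing [RHS]surjective_pairing e1 e2.
  + by move=> i; exact: (valP (enum_val i)).
  + move=> v a j _ ja; left.
    have ab : (mdeg a < b)%N.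
      by rewrite ltnNge; apply/negP => /chi0 e0; rewrite e0 in ja.
    pose x : bmultinom d b * 'I_r := (BMultinom ab, j).
    exists (enum_rank (exist _ x ja : {x : bmultinom d b * 'I_r | (x.2 < chi x.1)%N})).
    by rewrite /e enum_rankK.
- move=> a; exists (chi a) => //.
  pose e (i : 'I_(chi a)) := (a, widen_ord (chi_r a) i).
  apply: (monomial_dim (e := e)) => //.
  + by move=> i j [ij]; exact: val_inj.
  + move=> i; apply/homogP => c j ca; rewrite coef_monomial xpair_eqE.
    by rewrite (negPf ca).
  + by move=> i /=; exact: ltn_ord.
  + move=> v c j /homogP hv jc; have [ca|ca] := eqVneq c a; last by right; exact: hv.
    left; rewrite ca in jc; exists (Ordinal jc); rewrite /e ca; congr (_, _); exact: val_inj.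
Qed.

End Charfun.

(** * Monotone lattice paths in the structure of a characteristic function *)

Section MonotonePath.
Variables (r d : nat) (chi : multinom d -> int).
Hypothesis chi_mono : forall a b, mnmle a b -> chi b <= chi a.
Local Notation ct := (clos_trans _ (@inc _ (structure_of r chi))).
Implicit Types p q : {i : 'I_r.-1 & level_pts chi i}.

Definition in_pt p : set (multinom d) := sval (tagged p).

Lemma in_pt_level p a : in_pt p a -> chi a = r%:Z - (tag p).+1%:Z.
Proof. by case: p => i [C /= [_ CX _ _]] /CX. Qed.

Lemma in_pt_component p : component (level chi (tag p)) (in_pt p).
Proof. by case: p => i [C]. Qed.

Lemma in_pt_eq p q a : in_pt p a -> in_pt q a -> p = q.
Proof.
move=> pa qa; have := in_pt_level pa; rewrite (in_pt_level qa) => ij.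
have {}ij : tag p = tag q by apply: val_inj => /=; lia.
case: p q pa qa ij => [i [C Cc]] [j [D Dc]] /= Ca Da ij; subst j.
by congr (Tagged _ _); apply: eq_exist; exact: (component_eq Cc Dc Ca Da).
Qed.

(** By monotonicity the value at [c] lies between those at [a] and [b], so [c] is
    in one of the level sets that carry points of the structure. *)
Lemma exists_in_pt p q a b c : in_pt p a -> in_pt q b ->
  mnmle a c -> mnmle c b -> exists s, in_pt s c.
Proof.
move=> pa qb /chi_mono ac /chi_mono cb.
move: ac cb; rewrite (in_pt_level pa) (in_pt_level qb) => ac cb.
have := ltn_ord (tag q); have := ltn_ord (tag p) => ltp ltq.
pose i := `|r%:Z - chi c|.-1%N.
have lti : (i < r.-1)%N by rewrite /i; lia.
have [C Cc Ca] : exists2 C, component (level chi (Ordinal lti)) C & C c.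
  by apply: component_of; rewrite /level /= /i; lia.
by exists (existT (level_pts chi) (Ordinal lti) (exist _ C Cc)).
Qed.

(** Induction along a saturated chain from [a] to [b]: each step either stays in
    the same component or is an incidence. *)
Lemma mnmle_clos_trans p q a b : in_pt p a -> in_pt q b -> mnmle a b ->
  p = q \/ ct p q.
Proof.
have [n] := ubnP (mdeg b - mdeg a); elim: n p a => // n IH p a ltn pa qb ab.
have [ab_eq|neq] := eqVneq a b.
  by left; apply: (in_pt_eq pa); rewrite ab_eq.
have [i ib] := mnmle_step ab (elimN eqP neq).
have ai := mnmle_msucc a i.
have [s sc] := exists_in_pt pa qb ai ib.
have {IH} IH : s = q \/ ct s q.
  apply: (IH _ _ _ sc qb ib).
  by have := mnmle_mdeg ib; have := mnmle_mdeg ab; rewrite mdeg_msucc; lia.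
suff [->|ps] : p = s \/ @inc _ (structure_of r chi) p s.
- by [].
- by right; case: IH => [<-|]; [exact: t_step|exact: t_trans (t_step _ _ _ _ ps)].
have := chi_mono ai; rewrite (in_pt_level pa) (in_pt_level sc) => le_ps.
have [/val_inj ps|ps] := eqVneq (tag p : nat) (tag s).
  left; refine (in_pt_eq _ sc).
  apply: (component_adj (in_pt_component p) pa).
    by rewrite /level /= ps (in_pt_level sc).
  by right; exact: adjacent_msucc.
right; split; first by lia.
by exists a, (msucc a i); split=> //; exact: adjacent_msucc.
Qed.

End MonotonePath.

(** * From characteristic functions to compact sets *)

Lemma continuous_compose (T U W : topologicalType) (f : T -> U) (g : U -> W) :
  continuous f -> continuous g -> continuous (g \o f).
Proof. by move=> f_cont g_cont t; exact: (continuous_comp (f_cont t) (g_cont (f t))). Qed.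

Section Paths.
Variables (R : realType).

(** Composing with the retraction of the line onto [[0, 1]] makes paths total
    continuous functions, which can be concatenated without gluing. *)
Definition clamp (t : R) : R := Num.max 0 (Num.min 1 t).

Lemma clamp_continuous : continuous (clamp : R -> R).
Proof.
move=> t; apply: continuous_max; first exact: cvg_cst.
by apply: continuous_min; [exact: cvg_cst|exact: cvg_id].
Qed.

Lemma clamp_itv t : 0 <= clamp t <= 1.
Proof. by rewrite /clamp le_max lexx ge_max ge_min lexx ler01. Qed.

Lemma clamp_ge1 t : 1 <= t -> clamp t = 1.
Proof. by move=> t1; rewrite /clamp min_l // max_r. Qed.

Lemma clamp_le0 t : t <= 0 -> clamp t = 0.
Proof. by move=> t0; rewrite /clamp min_r ?max_l // (le_trans t0). Qed.

Variable V : normedModType R.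
Implicit Types (A B : set V) (x y z : V).

Definition path_joined A x y :=
  exists g : R -> V, [/\ continuous g, g 0 = x, g 1 = y & forall t, A (g t)].

Lemma path_joined_sub A B x y : A `<=` B -> path_joined A x y -> path_joined B x y.
Proof. by move=> AB [g [? ? ? gA]]; exists g; split=> // t; exact: AB. Qed.

(** At every time one of the two paths rests at [y], so the sum of the two minus
    [y] is their concatenation; its continuity is that of a sum. *)
Lemma path_joined_trans A x y z :
  path_joined A x y -> path_joined A y z -> path_joined A x z.
Proof.
move=> [g [g_cont g0 g1 gA]] [h [h_cont h0 h1 hA]].
exists (fun t => g (clamp (2 * t - 0)) + (h (clamp (2 * t - 1)) - y)).
have affine_clamp (c : R) : continuous (fun t : R => clamp (2 * t - c)).
  have aff : continuous ((fun t => 2 * t - c) : R -> R).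
    by move=> t; apply: cvgB; [apply: cvgM; [exact: cvg_cst|exact: cvg_id]|exact: cvg_cst].
  exact: (continuous_compose aff clamp_continuous).
split.
- move=> t; apply: cvgD; first exact: (continuous_compose (affine_clamp 0) g_cont).
  apply: cvgB; last exact: cvg_cst.
  exact: (continuous_compose (affine_clamp 1) h_cont).
- by rewrite !clamp_le0 ?g0 ?h0 ?subrr ?addr0 //; lra.
- rewrite !clamp_ge1; [by rewrite g1 h1 addrC subrK|lra..].
move=> t; have [t2|t2] := leP (2 * t) 1.
  by rewrite [X in h X]clamp_le0 ?h0 ?subrr ?addr0 //; lra.
rewrite [X in g X]clamp_ge1; last by lra.
by rewrite g1 addrC subrK.
Qed.

Lemma path_joined_convex A x y :
  (forall t, 0 <= t <= 1 -> A (x + t *: (y - x))) -> path_joined A x y.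
Proof.
move=> H; exists (fun t => x + clamp t *: (y - x)); split.
- move=> t; apply: cvgD; first exact: cvg_cst.
  by apply: cvgZ; [exact: clamp_continuous|exact: cvg_cst].
- by rewrite clamp_le0 // scale0r addr0.
- by rewrite clamp_ge1 // scale1r addrC subrK.
- by move=> t; apply: H; exact: clamp_itv.
Qed.

Lemma path_connected_joined A :
  (forall x y, A x -> A y -> path_joined A x y) -> path_connected R A.
Proof.
move=> H x y Ax Ay; have [g [g_cont g0 g1 gA]] := H x y Ax Ay.
by exists g; split=> //; exact: continuous_subspaceT.
Qed.

End Paths.

Lemma coord_le_norm (R : realType) n (x : 'rV[R]_n) j : `|x 0 j| <= `|x|.
Proof.
by rewrite [leRHS]/Num.Def.normr /= mx_normrE; apply/bigmax_geP; right; exists (0, j).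
Qed.

Section Cells.
Variables (R : realType) (n : nat).
Implicit Types (a b : multinom n.+1) (x : 'rV[R]_n.+1).

(** A coordinate form of the projection along the diagonal. *)
Definition proj x : 'rV[R]_n := \row_j (x 0 (lift ord0 j) - x 0 ord0).

(** A side of at least 1/2 makes the projections of adjacent cubes meet; a side
    below 1 lets projections meet only if the cubes have comparable corners. *)
Definition cube a : set 'rV[R]_n.+1 :=
  [set x | forall i, (a i)%:R <= x 0 i <= (a i)%:R + 2^-1].

Definition cell a : set 'rV[R]_n := proj @` cube a.

Lemma proj_is_linear : linear proj.
Proof. by move=> c x y; apply/rowP => j; rewrite !mxE; ring. Qed.

HB.instance Definition _ := GRing.isLinear.Build R _ _ _ proj proj_is_linear.

Lemma proj_continuous : continuous proj.
Proof.
apply: bounded_linear_continuous; apply/linear_boundedP; exists 2; split=> //.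
move=> c /ltW c2 x; apply: le_trans (ler_wpM2r _ c2) => //.
rewrite [leLHS]/Num.Def.normr /= mx_normrE bigmax_le ?mulr_ge0 // => -[i j] _ /=.
rewrite mxE (le_trans (ler_normB _ _)) //.
by have := coord_le_norm x ord0; have := coord_le_norm x (lift ord0 j); lra.
Qed.

Lemma cube_compact a : compact (cube a).
Proof.
apply: (@rV_compact R n.+1 (fun i => `[(a i)%:R, (a i)%:R + 2^-1]%classic)).
by move=> i; exact: segment_compact.
Qed.

Lemma cell_compact a : compact (cell a).
Proof.
apply: continuous_compact; last exact: cube_compact.
by apply: continuous_subspaceT; exact: proj_continuous.
Qed.

Lemma cell_joined a y z : cell a y -> cell a z -> path_joined (cell a) y z.
Proof.
move=> [x ax <-] [x' ax' <-]; apply: path_joined_convex => t t01.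
exists (x + t *: (x' - x)); last by rewrite linearD linearZ linearB.
move=> i; have := ax i; have := ax' i; rewrite !mxE; move: (x 0 i) (x' 0 i) => u v.
by nra.
Qed.

(** Points of the two cubes with the same projection differ by a constant vector
    [c]; if [c >= 0], then [b i <= x' i <= x i <= a i + 1/2] for all [i]. *)
Lemma cell_meet_comparable a b : cell a `&` cell b !=set0 ->
  mnmle a b \/ mnmle b a.
Proof.
move=> [_ [[x ax <-] [x' bx' e]]].
pose c := x 0 ord0 - x' 0 ord0.
have xE i : x 0 i = x' 0 i + c.
  case: (unliftP ord0 i) => [j ->|->]; last by rewrite /c; ring.
  have := congr1 (fun v : 'rV_n => v 0 j) e; rewrite !mxE /c => ej.
  by lra.
have half (k l : nat) : k%:R <= l%:R + 2^-1 :> R -> (k <= l)%N.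
  move=> kl; rewrite -ltnS -(ltr_nat R) -natr1; lra.
have [c0|c0] := leP c 0; [left|right] => i; apply: half;
  have := ax i; have := bx' i; rewrite xE; lra.
Qed.

(** The cubes at [c] and [c + e_i] contain the points [x] and
    [x + (1/2, ..., 1/2)], where [x] is [c] with its [i]-th coordinate moved to
    the far end of the cube. *)
Lemma cell_meet_adjacent a b : adjacent a b -> cell a `&` cell b !=set0.
Proof.
suff H c i : cell c `&` cell (msucc c i) !=set0.
  by move=> /adjacentP[i [->|->]] //; rewrite setIC.
pose x : 'rV[R]_n.+1 := \row_j ((c j)%:R + if j == i then 2^-1 else 0).
exists (proj x); split.
  by exists x => // j; rewrite !mxE; case: ifP => _; lra.
exists (x + const_mx 2^-1); last first.
  by rewrite linearD /= [X in _ + X](_ : _ = 0) ?addr0 //; apply/rowP => j; rewrite !mxE subrr.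
move=> j; rewrite !mxE msuccE eq_sym natrD; case: eqVneq => _ /=; lra.
Qed.

Lemma cell_nonempty a : cell a !=set0.
Proof.
exists (proj (\row_j (a j)%:R)), (\row_j (a j)%:R) => // j; rewrite mxE; lra.
Qed.

End Cells.

Section Forward.
Variables (R : realType) (r n : nat).

Lemma bigcup_cell_compact (C : set (multinom n.+1)) : finite_set C ->
  compact (\bigcup_(a in C) @cell R n a).
Proof.
move=> finC; rewrite -bigsetU_fset_set //.
by apply: bigsetU_compact => a _; exact: cell_compact.
Qed.

Lemma bigcup_cell_path_connected (C : set (multinom n.+1)) :
  lattice_connected C -> path_connected R (\bigcup_(a in C) @cell R n a).
Proof.
move=> /lattice_connectedP C_conn; apply: path_connected_joined.
move=> y z [a Ca ay] [b Cb bz].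
set U := \bigcup_(_ in _) _.
have sub c : C c -> cell c `<=` U by move=> Cc x cx; exists c.
suff : forall z, cell b z -> path_joined U y z by exact.
apply: (@linked_ind _ C (fun b => forall z, cell b z -> path_joined U y z) a b).
- exact: C_conn.
- by move=> x ax; exact: path_joined_sub (sub a Ca) (cell_joined ay ax).
move=> c c' Cc Cc' cc' IH x c'x.
have [x' [cx' c'x']] := @cell_meet_adjacent R n _ _ cc'.
apply: path_joined_trans (IH _ cx') _.
exact: path_joined_sub (sub c' Cc') (cell_joined c'x' c'x).
Qed.

(** Incidences become edges because adjacent cells meet; edges are in the
    transitive closure of the incidences because meeting cells are comparable. *)
Lemma intersection_graph_of_charfun N (chi : multinom n.+1 -> int) :
  charfun r N chi -> finite_structure (structure_of r chi) ->
  exists (m : nat) (K : 'I_m -> set 'rV[R]_n)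
         (part : intersection_graph K -> 'I_r.-1),
    [/\ forall i, [/\ K i !=set0, path_connected R (K i) & compact (K i)],
        multipartite part &
        equivalent (structure_of r chi) (structure_of_graph part)].
Proof.
move=> /charfun_props[chi_mono chi_fin] /sigma_enum[m [g [g' g'K gK]]].
pose K (v : 'I_m) := \bigcup_(a in in_pt (g v)) @cell R n a.
pose part (v : intersection_graph K) : 'I_r.-1 := tag (g v).
have meetP v w : K v `&` K w !=set0 -> [\/ g v = g w,
    clos_trans _ (@inc _ (structure_of r chi)) (g v) (g w) |
    clos_trans _ (@inc _ (structure_of r chi)) (g w) (g v)].
  move=> [x [[a va ax] [b wb bx]]].
  have [ab|ba] : mnmle a b \/ mnmle b a by apply: (@cell_meet_comparable R); exists x.
    by case: (mnmle_clos_trans chi_mono va wb ab); [constructor 1|constructor 2].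
  by case: (mnmle_clos_trans chi_mono wb va ba); [constructor 1|constructor 3].
exists m, K, part; split.
- move=> v; have [[a va] vX v_conn _] := in_pt_component (g v); split.
  + by have [x ax] := @cell_nonempty R n a; exists x, a.
  + exact: bigcup_cell_path_connected.
  + apply: bigcup_cell_compact; apply: sub_finite_set chi_fin => b /vX /=.
    by have := ltn_ord (tag (g v)); rewrite /level /= => ltr ->; lia.
- move=> v w [vw /meetP]; apply: contraPneq => part_vw.
  case=> [gvw|/clos_trans_lt|/clos_trans_lt].
  + by move: vw; rewrite -(g'K v) gvw g'K eqxx.
  + by rewrite /part in part_vw; rewrite part_vw ltnn.
  + by rewrite /part in part_vw; rewrite part_vw ltnn.
have tagP i (x : level_pts chi i) : part (g' (Tagged _ x)) == i.
  by rewrite /part gK.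
pose f i (x : level_pts chi i) : graph_pts part i :=
  exist (fun v => part v == i) _ (tagP i x).
apply: (@equivalent_of_inc _ (structure_of r chi) (structure_of_graph part) f)
    => [i|[i x] [j y]|[i x] [j y]].
- rewrite -setTT_bijective; split=> //.
    move=> x y _ _ xy; apply: Tagged_inj; apply: (can_inj gK).
    exact: (congr1 val xy).
  move=> [v vi] _; have /eqP := vi; rewrite /part.
  case gv : (g v) => [j x] /= ji; subst j; exists x => //.
  by apply: val_inj; rewrite /= -[RHS]g'K gv.
- move=> [lt_ij [a [b [xa yb ab le_ab]]]]; apply: t_step; split=> //=.
  split.
    apply: contra_ltnN lt_ij => /eqP /(can_inj gK) e.
    by have /= -> := congr1 tag e.
  have [z [az bz]] := @cell_meet_adjacent R n _ _ ab.
  by exists z; split; [exists a|exists b] => //; rewrite gK.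
- move=> [[_ /meetP] /= + lt_ij]; rewrite !gK.
  case=> [e|//|/(@clos_trans_lt _ (structure_of r chi)) /=]; last by rewrite ltnNge ltnW.
  by have /= ij := congr1 tag e; rewrite -ij ltnn in lt_ij.
Qed.

End Forward.

(** * From discretized sets to a characteristic function *)

Section Realization.
Variables (r n N : nat) (G : graph) (part : G -> 'I_r.-1).
Variable Q : G -> set (multinom n).
Hypothesis part_ok : multipartite part.
Hypothesis Q_nonempty : forall v, Q v !=set0.
Hypothesis Q_conn : forall v, lattice_connected (Q v).
Hypothesis Q_deg : forall v q, Q v q -> (mdeg q <= N)%N.
Hypothesis Q_edge : forall v w, edge v w -> Q v `&` Q w !=set0.
Hypothesis Q_close : forall v w q q', v != w -> Q v q -> Q w q' ->
  (forall j, (q j <= q' j + 2 * r)%N /\ (q' j <= q j + 2 * r)%N) -> edge v w.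

Definition mcons k (q : multinom n) : multinom n.+1 := Multinom [tuple of k :: q].

Lemma mcons0 k q : mcons k q ord0 = k.
Proof. by rewrite mnm_tnth /= tnth0. Qed.

Lemma mconsS k q j : mcons k q (lift ord0 j) = q j.
Proof. by rewrite mnm_tnth /= tnthS. Qed.

Lemma mdeg_mcons k q : mdeg (mcons k q) = (k + mdeg q)%N.
Proof.
rewrite !mdegE big_ord_recl mcons0; congr (_ + _)%N.
by apply: eq_bigr => j _; rewrite mconsS.
Qed.

Lemma mnmle_mcons k l q q' :
  (k <= l)%N -> mnmle q q' -> mnmle (mcons k q) (mcons l q').
Proof.
move=> kl qq' i; case: (unliftP ord0 i) => [j ->|->]; first by rewrite !mconsS.
by rewrite !mcons0.
Qed.

(** The heights of consecutive parts differ by 2: the points one degree below the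
    lifts of [Q v], through which neighbouring lifts are linked, then still have
    larger degree than all lifts of the parts before that of [v]. *)
Definition height v := (2 * part v).+1.

(** The lift of [q] to the points of degree [N + height v]. *)
Definition top v q := mcons (N + height v - mdeg q) q.

Definition down v : set (multinom n.+1) :=
  [set a | exists2 q, Q v q & mnmle a (top v q)].

Definition region v : set (multinom n.+1) :=
  [set a | [/\ (N <= mdeg a)%N, down v a &
               forall w, (part w < part v)%N -> ~ down w a]].

(** Monotone because every [down v] is a lower set.  The value [r] in low degrees
    keeps the regions of distinct vertices apart: all sets [down v] contain the
    origin. *)
Definition real_chi (a : multinom n.+1) : nat :=
  if (mdeg a < N)%N then r else \max_(v : G | `[< down v a >]) (r.-1 - part v).
Local Notation chi := (fun a => (real_chi a)%:Z).

Lemma height_lt v : (height v < 2 * r)%N.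
Proof. by have := ltn_ord (part v); rewrite /height; lia. Qed.

Lemma mdeg_top v q : Q v q -> mdeg (top v q) = (N + height v)%N.
Proof.
by move=> /Q_deg qN; rewrite mdeg_mcons subnK // (leq_trans qN) // leq_addr.
Qed.

Lemma down_mdeg v a : down v a -> (mdeg a <= N + height v)%N.
Proof. by move=> [q Qq /mnmle_mdeg]; rewrite mdeg_top. Qed.

Lemma down_mnmle v a b : mnmle a b -> down v b -> down v a.
Proof. by move=> ab [q Qq bq]; exists q => //; exact: mnmle_trans bq. Qed.

Lemma real_chi_le a : (real_chi a <= r)%N.
Proof.
rewrite /real_chi; case: ifP => // _; apply/bigmax_leqP => v _.
by rewrite (leq_trans (leq_subr _ _)) // leq_pred.
Qed.

Lemma real_chi_mono a b : mnmle a b -> (real_chi b <= real_chi a)%N.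
Proof.
move=> ab; rewrite {2}/real_chi; case: ifP => [_|aN]; first exact: real_chi_le.
rewrite /real_chi; case: ifP => [bN|_].
  by rewrite (leq_ltn_trans (mnmle_mdeg ab) bN) in aN.
apply/bigmax_leqP => v /asboolP bv.
apply: (@leq_bigmax_cond _ _ (fun v => r.-1 - part v)%N v).
by apply/asboolP; exact: down_mnmle bv.
Qed.

Lemma real_chi_support a : (N + 2 * r <= mdeg a)%N -> real_chi a = 0%N.
Proof.
move=> a_big; rewrite /real_chi ifF; last by lia.
rewrite big_pred0 // => v; apply/asboolP => /down_mdeg.
by have := height_lt v; lia.
Qed.

Lemma real_chi_charfun : exists B, charfun r B chi.
Proof.
exact: charfun_intro real_chi_le real_chi_mono real_chi_support.
Qed.

Lemma levelP (i : 'I_r.-1) a :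
  level chi i a <-> exists2 v, part v = i & region v a.
Proof.
have lti := ltn_ord i.
rewrite /level /=; split=> [chi_a|[v vi [aN av not_w]]].
  have {}chi_a : real_chi a = (r.-1 - i)%N by lia.
  move: (chi_a); rewrite /real_chi; case: ifP => [_|aN]; first by lia.
  case: (pickP (fun v : G => `[< down v a >])) => [v0 av0|no_v]; last first.
    by rewrite big_pred0 //; lia.
  have card_gt0 : (0 < #|[pred v : G | `[< down v a >]]|)%N.
    by apply/card_gt0P; exists v0.
  have [v /asboolP av ->] := eq_bigmax_cond (fun v : G => r.-1 - part v)%N card_gt0.
  have := ltn_ord (part v) => ltv vi.
  exists v; first by apply: val_inj => /=; lia.
  split=> // [|w wv aw]; first by lia.
  move: chi_a; rewrite /real_chi aN => chi_a.
  have := @leq_bigmax_cond _ (fun v : G => `[< down v a >]) (fun v => r.-1 - part v)%N w.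
  by rewrite chi_a => /(_ (asboolT aw)); lia.
have -> : real_chi a = (r.-1 - i)%N; last by lia.
rewrite /real_chi ifF; last by lia.
apply/eqP; rewrite eqn_leq; apply/andP; split.
  apply/bigmax_leqP => w /asboolP aw; rewrite leq_sub2l // -vi leqNgt.
  by apply/negP => /not_w.
rewrite -vi; apply: (@leq_bigmax_cond _ _ (fun v => r.-1 - part v)%N v).
exact/asboolP.
Qed.

(** The points [a] and [b] are within [height < 2 * r] of lifts of points of
    [Q v] and [Q w], so the latter are close. *)
Lemma region_close v w a b : region v a -> region w b ->
  a = b \/ adjacent a b -> v != w -> edge v w.
Proof.
move=> [aN [q vq aq] _] [bN [q' wq' bq'] _] ab vw.
apply: (Q_close vw vq wq') => j.
have := mnmle_diff (lift ord0 j) aq; have := mnmle_diff (lift ord0 j) bq'.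
have := aq (lift ord0 j); have := bq' (lift ord0 j).
rewrite !mdeg_top // !mconsS.
have := height_lt v; have := height_lt w.
suff : (a (lift ord0 j) <= (b (lift ord0 j)).+1)%N /\
       (b (lift ord0 j) <= (a (lift ord0 j)).+1)%N by lia.
case: ab => [->|/adjacentP[i [->|->]]]; first by rewrite leqnSn.
  by rewrite msuccE; case: eqP => _ /=; lia.
by rewrite msuccE; case: eqP => _ /=; lia.
Qed.

Lemma region_same_part v w a b : region v a -> region w b ->
  a = b \/ adjacent a b -> part v = part w -> v = w.
Proof.
move=> va wb ab vw; apply/eqP; apply: contraT => neq.
by have := part_ok (region_close va wb ab neq); rewrite vw eqxx.
Qed.

(** In the two topmost degrees of [down v] the degree alone excludes the lower sets
    of the parts before that of [v]. *)
Lemma high_region v a : down v a -> (N + height v <= (mdeg a).+1)%N -> region v a.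
Proof.
move=> av hv; split=> // [|w wv /down_mdeg]; first by rewrite /height in hv; lia.
by rewrite /height in hv *; lia.
Qed.

Lemma top_region v q : Q v q -> region v (top v q).
Proof.
move=> vq; apply: high_region; last by rewrite mdeg_top.
by exists q => //; exact: mnmle_refl.
Qed.

(** The lifts of [p] and [p + e_i] both cover the point [s] obtained from the
    lift of [p] by lowering its first coordinate by one. *)
Lemma top_linked v q q' : Q v q -> Q v q' -> adjacent q q' ->
  linked (region v) (top v q) (top v q').
Proof.
suff H p i : Q v p -> Q v (msucc p i) ->
    linked (region v) (top v p) (top v (msucc p i)).
  move=> vq vq' /adjacentP[i [q'E|qE]]; first by subst q'; exact: H.
  by subst q; apply: linked_sym; exact: H.
move=> vp vp'.
have dp := Q_deg vp; have dp' := Q_deg vp'; rewrite mdeg_msucc in dp'.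
pose s := mcons (N + height v - (mdeg p).+1) p.
have sp : mnmle s (top v p).
  by apply: mnmle_mcons; [lia|exact: mnmle_refl].
have sp' : mnmle s (top v (msucc p i)).
  by apply: mnmle_mcons; [rewrite mdeg_msucc|exact: mnmle_msucc].
have sdeg : (mdeg s).+1 = (N + height v)%N by rewrite mdeg_mcons; lia.
have link t : Q v t -> mnmle s (top v t) -> linked (region v) s (top v t).
  move=> vt st; apply: linked_mnmle => // c sc ct.
  apply: high_region; first by exists t.
  by have := mnmle_mdeg sc; lia.
by apply: linked_trans (link _ vp' sp'); exact: linked_sym (link _ vp sp).
Qed.

(** Every point of the region climbs to a lift without leaving the region, and
    the lifts are linked because [Q v] is connected. *)
Lemma region_connected v : lattice_connected (region v).
Proof.
have to_top a : region v a -> exists2 q, Q v q & linked (region v) a (top v q).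
  move=> [aN [q vq aq] not_w]; exists q => //; apply: linked_mnmle => // c ac cq.
  split=> [||w wv /(down_mnmle ac)]; [|by exists q|exact: not_w].
  exact: leq_trans aN (mnmle_mdeg ac).
have tops q q' : Q v q -> Q v q' -> linked (region v) (top v q) (top v q').
  move=> vq vq'; have /lattice_connectedP/(_ _ _ vq vq') := @Q_conn v.
  move=> qq'; apply: (@linked_ind _ _ (fun p => linked (region v) (top v q) (top v p)) _ _ qq').
    by apply: linked_refl; exact: top_region.
  by move=> x y vx vy xy /linked_trans; apply; exact: top_linked.
apply/lattice_connectedP => a b va vb.
have [q vq aq] := to_top _ va; have [q' vq' bq'] := to_top _ vb.
exact: linked_trans aq (linked_trans (tops _ _ vq vq') (linked_sym bq')).
Qed.

(** A path in the level set cannot leave the region of [v], since the next region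
    would belong to an adjacent vertex of the same part. *)
Lemma region_component v : component (level chi (part v)) (region v).
Proof.
split.
- by have [q vq] := Q_nonempty v; exists (top v q); exact: top_region.
- by move=> a va; apply/levelP; exists v.
- exact: region_connected.
move=> D DX /lattice_connectedP D_conn vD; apply/seteqP; split=> // b Db.
have [q vq] := Q_nonempty v; have va := top_region vq.
apply: (@linked_ind _ D (region v) _ _ (D_conn _ _ (vD _ va) Db)) => //.
move=> x y Dx Dy xy vx; have /levelP[w wv wy] := DX _ Dy.
by rewrite (region_same_part vx wy _ (esym wv)) //; right.
Qed.

Lemma region_inj v w a : region v a -> region w a -> part v = part w -> v = w.
Proof. by move=> va wa; apply: region_same_part va wa _; left. Qed.

(** Incidences are edges by [region_close].  An edge yields a common point [q] of
    [Q v] and [Q w], whose lifts are comparable, and [mnmle_clos_trans] applies. *)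
Lemma structure_of_real_chi :
  equivalent (structure_of_graph part) (structure_of r chi).
Proof.
have compP i (x : graph_pts part i) : component (level chi i) (region (val x)).
  by case: x => v /= /eqP <-; exact: region_component.
pose f i (x : graph_pts part i) : level_pts chi i :=
  exist (component (level chi i)) _ (compP i x).
apply: (@equivalent_of_inc _ (structure_of_graph part) (structure_of r chi) f)
    => [i|[i x] [j y]|[i x] [j y]].
- rewrite -setTT_bijective; split=> //.
    move=> x y _ _ xy; apply: val_inj.
    have /= e : region (val x) = region (val y) := congr1 sval xy.
    have [q xq] := Q_nonempty (val x); have xa := top_region xq.
    apply: (region_inj xa); first by rewrite -e.
    by rewrite (eqP (valP x)) (eqP (valP y)).
  move=> [C compC] _; have [[a Ca] CX _ _] := compC.
  have /levelP[v /eqP vi va] := CX _ Ca.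
  exists (exist (fun v => part v == i) v vi) => //.
  by apply: eq_exist; exact: (component_eq (compP i (exist _ v vi)) compC va Ca).
- move=> [/= xy lt_ij]; have [q [xq yq]] := Q_edge xy.
  have := @mnmle_clos_trans r n.+1 chi _ (existT _ i (f i x)) (existT _ j (f j y)).
  move=> /(_ _ (top (val x) q) (top (val y) q)) [].
  + by move=> a b ab; rewrite lez_nat real_chi_mono.
  + exact: top_region.
  + exact: top_region.
  + apply: mnmle_mcons; last exact: mnmle_refl.
    rewrite /height (eqP (valP x)) (eqP (valP y)).
    by have := Q_deg xq; lia.
  + by move=> e; have /= ij := congr1 tag e; rewrite ij ltnn in lt_ij.
  + by [].
- move=> [/= lt_ij [a [b [xa yb ab _]]]]; apply: t_step; split=> //=.
  apply: (region_close xa yb); first by right.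
  apply: contraTneq lt_ij => xy.
  have <- : i = j.
    exact: etrans (esym (eqP (valP x))) (etrans (congr1 part xy) (eqP (valP y))).
  by rewrite ltnn.
Qed.

End Realization.

(** * Discretizing compact sets *)

Section Discretization.
Variable R : realType.

(** A locally constant property is constant, as its preimage under a path is open
    and closed in the unit interval. *)
Lemma path_connected_constant (T : topologicalType) (A P : set T) :
  path_connected R A ->
  (forall x, A x -> \forall y \near x, A y -> (P x <-> P y)) ->
  forall x y, A x -> A y -> P x -> P y.
Proof.
move=> pathA locP x y Ax Ay Px.
have [g [/subspace_continuousP g_cont g0 g1 gA]] := pathA x y Ax Ay.
pose I : set R := `[0, 1]%classic.
have I_gA (t : R) : I t -> A (g t) by rewrite /I /= in_itv /= => /gA.
have loc (t : R) : I t -> \forall s \near t, I s -> (P (g t) <-> P (g s)).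
  move=> tI.
  have near_t : nbhs t [set s | I s -> A (g s) -> (P (g t) <-> P (g s))].
    exact: (g_cont t tI _ (locP _ (I_gA _ tI))).
  by apply: filterS near_t => s sP sI; apply: sP => //; exact: I_gA.
have I0 : I 0 by rewrite /I /= in_itv /= lexx ler01.
have I1 : I 1 by rewrite /I /= in_itv /= lexx ler01.
pose B := I `&` (P \o g).
suff BI : B = I.
  have [_ /=] : B 1 by rewrite BI.
  by rewrite g1.
refine (@segment_connected R 0 1 B _ _ _).
- by exists 0; split => //=; rewrite g0.
- exists (interior [set t | I t -> P (g t)]); first exact: open_interior.
  apply/seteqP; split=> t [tI Pt]; split=> //.
    by apply: filterS (loc t tI) => s ts /ts <-.
  by have := interior_subset Pt; apply.
- exists (~` interior [set t | I t -> ~ P (g t)]).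
    exact: open_closedC (@open_interior _ _).
  apply/seteqP; split=> t [tI Pt]; split=> //.
    by move=> /interior_subset /(_ tI); apply.
  apply: contrapT => nPt; apply: Pt.
  by apply: filterS (loc t tI) => s ts /ts Ps /Ps.
Qed.

Variables (n m : nat) (K : 'I_m -> set 'rV[R]_n).
Hypothesis K_nonempty : forall v, K v !=set0.
Hypothesis K_path : forall v, path_connected R (K v).
Hypothesis K_compact : forall v, compact (K v).

Lemma compacts_bounded : exists M : nat,
  forall v x j, K v x -> `|x 0 j| <= M%:R.
Proof.
have bnd v : exists M : nat, forall x j, K v x -> `|x 0 j| <= M%:R.
  have [M [_ HM]] := compact_bounded (@K_compact v).
  exists (Num.truncn `|M|).+2 => x j Kx; apply: le_trans (coord_le_norm x j) _.
  apply: HM Kx; rewrite (le_lt_trans (ler_norm M)) //.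
  by rewrite (lt_trans (truncnS_gt _)) // ltr_nat.
exists (\max_v sval (cid (bnd v))) => v x j Kx.
apply: le_trans (svalP (cid (bnd v)) x j Kx) _.
by rewrite ler_nat; exact: (@leq_bigmax _ (fun v => sval (cid (bnd v))) v).
Qed.

(** Disjoint compact sets have a positive distance, so at a large scale [L] they
    are more than [b] apart in some coordinate. *)
Lemma compacts_separated (b : R) : 0 <= b -> exists L : nat,
  forall v w x y, K v x -> K w y ->
  (forall j, L%:R * `|x 0 j - y 0 j| <= b) -> K v `&` K w !=set0.
Proof.
move=> b0.
have sep (p : 'I_m * 'I_m) : exists L : nat, forall x y, K p.1 x -> K p.2 y ->
    (forall j, L%:R * `|x 0 j - y 0 j| <= b) -> K p.1 `&` K p.2 !=set0.
  case: p => v w /=; have [vw|disj] := pselect (K v `&` K w !=set0); first by exists 0%N.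
  have cvw := compact_setX (@K_compact v) (@K_compact w).
  have nvw : K v `*` K w !=set0.
    by have [x vx] := K_nonempty v; have [y wy] := K_nonempty w; exists (x, y).
  pose f (z : 'rV[R]_n * 'rV[R]_n) : R := `|z.1 - z.2|.
  have f_cont : continuous f.
    by move=> z; apply: cvg_norm; apply: cvgB; [exact: cvg_fst|exact: cvg_snd].
  have [z /set_mem[vz wz] fz] := compact_EVT_min nvw cvw (continuous_subspaceT f_cont).
  have fz0 : 0 < f z.
    rewrite normr_gt0 subr_eq0; apply/eqP => z12; apply: disj.
    by exists z.1; split=> //; rewrite z12.
  exists (Num.truncn (b / f z)).+1 => x y vx wy xy.
  have L_gt : b / f z < (Num.truncn (b / f z)).+1%:R by exact: truncnS_gt.
  have L0 : 0 < (Num.truncn (b / f z)).+1%:R :> R by rewrite ltr0n.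
  have /(_ (x, y)) := fz; rewrite inE /= => /(_ (conj vx wy)); rewrite {2}/f /=.
  suff : `|x - y| <= b / (Num.truncn (b / f z)).+1%:R.
    move=> xyb fxy; have := le_trans fxy xyb.
    by rewrite ler_pdivlMr // mulrC -ler_pdivlMr // leNgt L_gt.
  rewrite [leLHS]/Num.Def.normr /= mx_normrE bigmax_le ?divr_ge0 // => -[i j] _ /=.
  by rewrite !mxE ler_pdivlMr // mulrC ord1.
exists (\max_p sval (cid (sep p))) => v w x y vx wy xy.
apply: (svalP (cid (sep (v, w))) x y vx wy) => j; apply: le_trans (xy j).
rewrite ler_wpM2r // ler_nat.
exact: (@leq_bigmax _ (fun p => sval (cid (sep p))) (v, w)).
Qed.

(** The lattice points within distance 2 of the rescaled set.  Rounding a point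
    down moves it by at most 1, so the rounding of a nearby point is within 2 of
    it as well: this slack connects the roundings along paths.  The translation
    [c] makes all coordinates nonnegative. *)
Lemma discretization (r : nat) : exists (N : nat) (Q : 'I_m -> set (multinom n)),
  [/\ forall v, Q v !=set0, forall v, lattice_connected (Q v),
      forall v q, Q v q -> (mdeg q <= N)%N,
      forall v w, K v `&` K w !=set0 -> Q v `&` Q w !=set0 &
      forall v w q q', Q v q -> Q w q' ->
        (forall j, (q j <= q' j + 2 * r)%N /\ (q' j <= q j + 2 * r)%N) ->
        K v `&` K w !=set0].
Proof.
have [M HM] := compacts_bounded.
(* lattice points within [2 * r] of each other come from rescaled points within
   [2 * r + 2 + 2] *)
have [L HL] := @compacts_separated (2 * r + 4)%:R (ler0n _ _).
pose c := (L * M + 2)%N.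
pose u (x : 'rV[R]_n) j : R := L%:R * x 0 j + c%:R.
pose Q v : set (multinom n) :=
  [set q | exists2 x, K v x & forall j, `|(q j)%:R - u x j| <= 2].
pose fl x : multinom n := Multinom [tuple Num.truncn (u x j) | j < n].
have u_bnd v x j : K v x -> 2 <= u x j <= (2 * c)%:R - 2.
  move=> vx; have := HM _ _ j vx; rewrite /u /c ler_norml natrM !natrD natrM => /andP[x1 x2].
  by have := ler0n R L; nra.
have flP v x j : K v x -> `|(fl x j)%:R - u x j| <= 1.
  move=> vx; have /andP[u2 _] := u_bnd v x j vx; rewrite mnmE.
  have /andP[] : (Num.truncn (u x j))%:R <= u x j < (Num.truncn (u x j)).+1%:R.
    by apply: truncn_itv; lra.
  by rewrite -natr1 ler_norml; lra.
have flQ v x : K v x -> Q v (fl x).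
  by move=> vx; exists x => // j; have := flP v x j vx; lra.
(* the lattice points near [x] form a box, in which any two points are linked
   through their minimum *)
have box v x (q q' : multinom n) : K v x -> (forall j, `|(q j)%:R - u x j| <= 2) ->
    (forall j, `|(q' j)%:R - u x j| <= 2) -> linked (Q v) q q'.
  move=> vx; pose p (q q' : multinom n) : multinom n := Multinom [tuple minn (q j) (q' j) | j < n].
  suff H (q1 q2 : multinom n) : (forall j, `|(q1 j)%:R - u x j| <= 2) ->
      (forall j, `|(q2 j)%:R - u x j| <= 2) -> linked (Q v) (p q1 q2) q2.
    move=> qx q'x; apply: linked_trans (H _ _ qx q'x).
    have -> : p q q' = p q' q by apply/mnmP => j; rewrite !mnmE minnC.
    by apply: linked_sym; exact: H.
  move=> q1x q2x; apply: linked_mnmle => [j|q0 pq0 q02]; first by rewrite mnmE geq_minr.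
  exists x => // j; have := pq0 j; have := q02 j; rewrite mnmE.
  have := q1x j; have := q2x j; rewrite !ler_norml => /andP[a1 a2] /andP[b1 b2].
  rewrite -(ler_nat R) => q02j; rewrite geq_min -!(ler_nat R) => /orP[]; lra.
exists (\sum_(j < n) 2 * c)%N, Q; split.
- by move=> v; have [x vx] := K_nonempty v; exists (fl x); exact: flQ.
- move=> v; apply/lattice_connectedP => q q' [x vx qx] [y vy q'y].
  have flbox z j : K v z -> `|(fl z j)%:R - u z j| <= 2.
    by move=> vz; have := flP v z j vz; lra.
  apply: (linked_trans (b := fl x)); first by apply: (box v x) => // j; exact: flbox.
  apply: (linked_trans (b := fl y)); last by apply: (box v y) => // j; exact: flbox.
  apply: (path_connected_constant (P := fun z => linked (Q v) (fl x) (fl z))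
    (@K_path v) _ vx vy); last by apply: linked_refl; exact: flQ.
  move=> z vz.
  have e0 : 0 < (L.+1%:R)^-1 :> R by rewrite invr_gt0 ltr0n.
  apply: filterS (nbhsx_ballx z _ e0) => z' [_ zz'] vz'.
  suff lzz' : linked (Q v) (fl z) (fl z').
    by split=> [/linked_trans|/linked_trans]; apply => //; exact: linked_sym.
  apply: (box v z) => // j; first exact: flbox.
  have := flP v z' j vz'; have := zz' 0 j; rewrite /ball /= => zj flj.
  have : `|u z j - u z' j| <= 1.
    rewrite /u opprD addrACA subrr addr0 -mulrBr normrM ger0_norm //.
    have := ltW zj; rewrite -(ler_pM2l (x := L.+1%:R)) ?ltr0n // divff ?pnatr_eq0 //.
    by apply: le_trans; rewrite ler_wpM2r // ler_nat.
  by move: flj; rewrite !ler_norml => /andP[? ?] /andP[? ?]; apply/andP; split; lra.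
- move=> v q [x vx qx]; rewrite mdegE; apply: leq_sum => j _.
  have := u_bnd v x j vx; have := qx j; rewrite -(ler_nat R) ler_norml.
  by move=> /andP[? ?] /andP[? ?]; lra.
- by move=> v w [x [vx wx]]; exists (fl x); split; exact: flQ.
move=> v w q q' [x vx qx] [y wy q'y] qq'; apply: (HL v w x y vx wy) => j.
have := qx j; have := q'y j; have [] := qq' j.
rewrite -!(ler_nat R) !natrD => h1 h2.
have -> : L%:R * `|x 0 j - y 0 j| = `|u x j - u y j|.
  by rewrite /u opprD addrACA subrr addr0 -mulrBr normrM ger0_norm.
rewrite !ler_norml => /andP[? ?] /andP[? ?]; apply/andP; split; lra.
Qed.

End Discretization.

(** * Incidence structures of characteristic functions *)

Theorem theorem18 (R : realType) (r d : nat) (hr : (1 <= r)%N) (hd : (1 <= d)%N)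
    (S : incidence_structure r.-1) (hS : finite_structure S) :
  (exists (n : nat) (chi : multinom d -> int),
      charfun r n chi /\ equivalent (structure_of r chi) S) <->
  (exists (m : nat) (K : 'I_m -> set 'rV[R]_d.-1)
          (part : intersection_graph K -> 'I_r.-1),
      [/\ forall i, [/\ K i !=set0, path_connected R (K i) & compact (K i)],
          multipartite part &
          equivalent S (structure_of_graph part)]).
Proof.
case: d hd => // n _; split.
  move=> [N [chi [chiP chi_S]]].
  have S_chi := equivalent_sym chi_S.
  have [m [K [part [KP part_ok chi_part]]]] :=
    @intersection_graph_of_charfun R r n N chi chiP
      (finite_structure_equivalent S_chi hS).
  by exists m, K, part; split=> //; exact: equivalent_trans S_chi chi_part.
move=> [m [K [part [KP part_ok S_part]]]].
have K_nonempty v : K v !=set0 by case: (KP v).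
have K_path v : path_connected R (K v) by case: (KP v).
have K_compact v : compact (K v) by case: (KP v).
have [N [Q [Q0 Q_conn Q_deg Q_meet Q_close]]] :=
  discretization K_nonempty K_path K_compact r.
have [B chiP] := @real_chi_charfun r n N (intersection_graph K) part Q Q_deg.
exists B, (fun a => (@real_chi r n N (intersection_graph K) part Q a)%:Z).
split=> //; apply: equivalent_sym; apply: equivalent_trans S_part _.
apply: structure_of_real_chi => // [v w [_]|v w q q' vw vq wq' qq'].
  exact: Q_meet.
by split=> //; exact: Q_close qq'.
Qed.
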